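(* Let $n\ge 1$, let $x_{-1}\in\{-1,1\}$, and let $\omega_0,\omega_1\in\mathbb{R}$ satisfy $\left|\omega_0-\tfrac12\right|+|\omega_1|<\tfrac12$. Consider $n$ flips $\mathbf{X}=(X_0,\dots,X_{n-1})$ of the history-cognizant coin with memory depth $m=1$, i.e. each $X_k$ takes values in $\{-1,1\}$, $X_{-1}=x_{-1}$, and $$\Pr(X_k=1\mid X_{k-1},X_{k-2},\dots)=\Pr(X_k=1\mid X_{k-1})=\omega_0+\omega_1X_{k-1},\qquad k=0,1,\dots,n-1.$$ Then the expected logarithmic growth $\mathrm{ELG}(K)$, over $-1\le K\le 1$, is maximized by $$K_n=2\left\{\frac{\mathbb{E}(H_n(\mathbf{X}))}{n}\right\}-1,$$ where $H_n(\mathbf{X})$ is the number of heads in $\mathbf{X}$, and where the expected value is obtained as the convex combination $$\frac{\mathbb{E}(H_n(\mathbf{X}))}{n}=\lambda_n p_0+(1-\lambda_n)p_\infty,$$ with $$p_0=\omega_0+\omega_1x_{-1},\qquad p_\infty=\frac{\omega_0-\omega_1}{1-2\omega_1},\qquad \lambda_n=\frac1n\left[\frac{1-(2\omega_1)^n}{1-2\omega_1}\right].$$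
   Context: Even-money coin-flipping game: $X_k=1$ is a head and $X_k=-1$ is a tail on flip $k$. A bettor has account value $V_0>0$ initially and bets $KV_k$ on flip $k$, with a constant $K\in[-1,1]$ ($K<0$ means betting on tails), so that $V_{k+1}=(1+KX_k)V_k$ and $$V_n(K,\mathbf{X})=V_0\prod_{k=0}^{n-1}(1+KX_k).$$ The expected logarithmic growth is $$\mathrm{ELG}(K)=\frac1n\,\mathbb{E}\left\{\log\left[\frac{V_n(K,\mathbf{X})}{V_0}\right]\right\},$$ with $\log 0=-\infty$. The value $X_{-1}=x_{-1}$ is a fixed, already observed outcome; all probabilities and expectations are for the process started from this value. $H_n(\mathbf{X})$ denotes the number of indices $k\in\{0,\dots,n-1\}$ with $X_k=1$. *)

(* Defs.v *)
From HB Require Import structures.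
From mathcomp Require Import all_boot all_order all_algebra.
From mathcomp Require Import all_classical all_reals all_analysis.

Set Implicit Arguments.
Unset Strict Implicit.
Unset Printing Implicit Defensive.

Import Order.TTheory GRing.Theory Num.Theory.
Import numFieldNormedType.Exports.

Local Open Scope classical_set_scope.
Local Open Scope ring_scope.

(* Pr(A | B); meaningful only when P B is positive, which every use below
   assumes explicitly. *)
Definition cond_prob d (T : measurableType d) (R : realType)
    (P : probability T R) (A B : set T) : R :=
  fine (P (A `&` B)) / fine (P B).

(* [prev xm1 X k] is X_(k-1): the fixed outcome xm1 when k = 0. *)
Definition prev d (T : measurableType d) (R : realType)
    (xm1 : R) (X : nat -> T -> R) (k : nat) : T -> R :=
  if k is j.+1 then X j else cst xm1.

(* The event X_(k-1) = h k, X_(k-2) = h (k-1), ..., X_(-1) = h 0. *)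
Definition history d (T : measurableType d) (R : realType)
    (xm1 : R) (X : nat -> T -> R) (k : nat) (h : nat -> R) : set T :=
  [set w | forall j, (j <= k)%N -> prev xm1 X j w = h j].

(* The coin of memory depth 1 over the flips 0, ..., n-1. Only X_0, ...,
   X_(n-1) are constrained. All outcomes being discrete, the conditional
   probabilities are elementary ones, required at every past of positive
   probability. *)
Definition history_cognizant_coin d (T : measurableType d) (R : realType)
    (P : probability T R) (n : nat) (xm1 w0 w1 : R) (X : nat -> T -> R) : Prop :=
  [/\ forall k, (k < n)%N -> forall w, X k w = 1 \/ X k w = -1,
      forall k, (k < n)%N -> forall h : nat -> R,
        (0 < P (history xm1 X k h))%E ->
        cond_prob P [set w | X k w = 1] (history xm1 X k h) =
        cond_prob P [set w | X k w = 1] [set w | prev xm1 X k w = h k] &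
      forall k, (k < n)%N -> forall y : R,
        (0 < P [set w | prev xm1 X k w = y])%E ->
        cond_prob P [set w | X k w = 1] [set w | prev xm1 X k w = y] =
        w0 + w1 * y].

Definition account (T : Type) (R : realType)
    (V0 K : R) (X : nat -> T -> R) (n : nat) (w : T) : R :=
  V0 * \prod_(k < n) (1 + K * X k w).

(* [lne] is the extended logarithm with lne 0 = -oo, so the value is -oo as
   soon as ruin has positive probability. *)
Definition ELG d (T : measurableType d) (R : realType)
    (P : probability T R) (V0 : R) (X : nat -> T -> R) (n : nat) (K : R)
    : \bar R :=
  ((n%:R^-1)%:E * \int[P]_w lne (account V0 K X n w / V0)%:E)%E.

Definition heads (T : Type) (R : realType)
    (X : nat -> T -> R) (n : nat) (w : T) : R :=
  #|[pred k : 'I_n | X k w == 1]|%:R.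

(* Main.v *)
Require Import Defs.
From HB Require Import structures.
From mathcomp Require Import all_boot all_order all_algebra.
From mathcomp Require Import all_classical all_reals all_analysis.
From mathcomp Require Import ring lra.

Set Implicit Arguments.
Unset Strict Implicit.
Unset Printing Implicit Defensive.

Import Order.TTheory GRing.Theory Num.Theory.
Import numFieldNormedType.Exports.

Local Open Scope classical_set_scope.
Local Open Scope ring_scope.

(** The account after [n] flips depends on the outcomes only through the number
    [H] of heads: it is [V0 (1 + K)^H (1 - K)^(n - H)]. Hence the growth
    depends on the law of the process only through [q := E(H) / n], and
    [ELG K = q log (1 + K) + (1 - q) log (1 - K)] for [|K| < 1], which Gibbs'
    inequality bounds by its value at [1 + K = 2 q].

    At [K = 1] and [K = -1] the logarithm can be [-oo]. These endpoints need no
    separate treatment if Gibbs' inequality is used before taking expectations: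
    the tangent bound [u <= s exp (u / s - 1)] holds for every [u], so
    ([lne_monomial_le]) the log-growth for any [K] in [-1, 1] is at most, at
    every sample point, the log-growth for [L := 2 q - 1] plus
      [H ((1 + K) / (1 + L) - 1) + (n - H) ((1 - K) / (1 - L) - 1)],
    an affine function of [H] whose expectation
      [n (q (1 + K) / (2 q) + (1 - q) (1 - K) / (2 (1 - q)) - 1)]
    vanishes. This is [ELG_max].

    For the value of [q], conditioning flip [k] on flip [k - 1] gives the affine
    recursion [p_k = (w0 - w1) + 2 w1 p_(k-1)] for the probability of heads
    ([prob_head_rec]). Its fixed point is [pinf], so
    [p_k = pinf + (2 w1)^k (p0 - pinf)] ([prob_head_closed]), and the average
    over [k] is the convex combination with weight [lam], the mean of the
    powers [(2 w1)^k]. The hypothesis on [w0] and [w1] keeps every [p_k], hence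
    [q], strictly between 0 and 1, so that [L] lies in the open interval where
    the tangent bound applies. *)

(** * Pointwise bounds *)

(** The positive and negative parts of the integral are suprema over the simple
    functions lying below [f^\+] and [f^\-], so they are monotone as such; the
    subtraction of extended reals is monotone even at infinite values. The
    integral of [f] may thus be [-oo], as is the case when ruin is possible. *)
Lemma le_integral_pointwise d (T : measurableType d) (R : realType)
    (mu : {measure set T -> \bar R}) (D : set T) (f g : T -> \bar R) :
  (forall x, D x -> (f x <= g x)%E) ->
  (\int[mu]_(x in D) f x <= \int[mu]_(x in D) g x)%E.
Proof.
move=> fg.
have fgD x : ((f \_ D) x <= (g \_ D) x)%E.
  by rewrite /patch; case: ifPn => // /set_mem; exact: fg.
have fgDT : {in setT, forall x, ((f \_ D) x <= (g \_ D) x)%E} by move=> x _.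
rewrite /integral leeB//; apply: le_ereal_sup => _ [h hle <-]; exists h => // x.
- by rewrite (le_trans (hle x))// (funepos_le fgDT)// inE.
- by rewrite (le_trans (hle x))// (funeneg_le fgDT)// inE.
Qed.

(** Exponential form of [log u - log s <= u / s - 1], which makes sense for
    [u = 0] too. *)
Lemma le_mul_expR (R : realType) (u s : R) : 0 < s ->
  u <= expR (ln s + (u / s - 1)).
Proof.
move=> s0; rewrite expRD lnK ?posrE// -ler_pdivrMl// mulrC.
by have := expR_ge1Dx (u / s - 1); rewrite addrC subrK.
Qed.

(** Bounding the factors before taking the logarithm covers [u = 0] and [v = 0]
    without distinguishing whether the exponents vanish. *)
Lemma lne_monomial_le (R : realType) (u v s t : R) (a b : nat) :
  0 <= u -> 0 <= v -> 0 < s -> 0 < t ->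
  (lne (u ^+ a * v ^+ b)%:E <=
   (a%:R * (ln s + (u / s - 1)) + b%:R * (ln t + (v / t - 1)))%:E)%E.
Proof.
move=> u0 v0 s0 t0; set E := (X in (_ <= X%:E)%E).
have uvE : u ^+ a * v ^+ b <= expR E.
  rewrite /E expRD !expRM_natl ler_pM ?exprn_ge0//;
    by rewrite lerXn2r ?nnegrE ?expR_ge0// le_mul_expR.
have [uv0|uv0] := leP (u ^+ a * v ^+ b) 0.
  by rewrite le0_lneNy ?lee_fin// leNye.
by rewrite lne_EFin// lee_fin -(expRK E) ler_ln// posrE expR_gt0.
Qed.

Lemma lne_monomial (R : realType) (s t : R) (a b : nat) :
  0 < s -> 0 < t ->
  lne (s ^+ a * t ^+ b)%:E = (a%:R * ln s + b%:R * ln t)%:E.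
Proof.
move=> s0 t0; rewrite lne_EFin ?mulr_gt0 ?exprn_gt0//.
by rewrite lnM ?posrE ?exprn_gt0// !lnXn// !mulr_natl.
Qed.

(** * Growth as a function of the number of heads *)

Section coin.
Context d (T : measurableType d) (R : realType) (P : probability T R).
Variables (n : nat) (X : nat -> T -> R).
Hypothesis mX : forall k y, measurable [set w | X k w = y].

Let H : T -> R := heads X n.

Lemma headsE : H = fun w => \sum_(k < n) \1_[set w | X k w = 1] w.
Proof.
apply/funext => w; rewrite /H /heads -sum1_card natr_sum big_mkcond/=.
apply: eq_bigr => k _; rewrite indicE inE/=; case: eqP => h.
  by rewrite mem_set.
by rewrite memNset.
Qed.

Lemma integrable_heads : P.-integrable setT (EFin \o H).
Proof.
rewrite headsE.
have -> : EFin \o (fun w => \sum_(k < n) \1_[set w | X k w = 1] w : R) =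
    fun w => (\sum_(k < n) (\1_[set w | X k w = 1] w : R)%:E)%E.
  by apply/funext => w /=; rewrite sumEFin.
apply: integrable_sum => // k _; exact: integrable_indic.
Qed.

Lemma expectation_heads :
  'E_P[heads X n]%E = (\sum_(k < n) fine (P [set w | X k w = 1]))%:E.
Proof.
rewrite unlock -/H headsE; under eq_integral do rewrite -sumEFin.
rewrite ge0_integral_sum//; last first.
  by move=> k; case/integrableP: (integrable_indic P (mX k 1)).
rewrite -sumEFin; apply: eq_bigr => k _.
by rewrite integral_indic// setIT fineK// fin_num_measure.
Qed.

Lemma integral_affine_heads (a b : R) :
  (\int[P]_w (H w * a + (n%:R - H w) * b)%:E =
  (fine 'E_P[heads X n] * a + (n%:R - fine 'E_P[heads X n]) * b)%:E)%E.
Proof.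
have EH : (\int[P]_w (H w)%:E = (fine 'E_P[heads X n])%:E)%E.
  by rewrite expectation_heads/= -expectation_heads unlock.
transitivity (\int[P]_w ((a - b)%:E * (H w)%:E + (n%:R * b)%:E))%E.
  by apply: eq_integral => w _; rewrite -EFinM -EFinD; congr EFin; ring.
rewrite integralD//=; last 2 first.
- by apply: integrableZl => //; exact: integrable_heads.
- exact: finite_measure_integrable_cst.
rewrite integralZl//; last exact: integrable_heads.
rewrite EH integral_cst// [X in (_ + _ * X)%E](_ : _ = 1%E); last first.
  exact: probability_setT.
rewrite mule1 -EFinM -EFinD.
by congr EFin; ring.
Qed.

Hypothesis X1 : forall k, (k < n)%N -> forall w, X k w = 1 \/ X k w = -1.

Lemma account_heads (V0 K : R) (w : T) : V0 != 0 ->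
  account V0 K X n w / V0 =
  (1 + K) ^+ #|[pred k : 'I_n | X k w == 1]| *
  (1 - K) ^+ #|[predC [pred k : 'I_n | X k w == 1]]|.
Proof.
move=> V00; rewrite /account mulrAC mulfV// mul1r.
rewrite (bigID [pred k : 'I_n | X k w == 1])/=; congr (_ * _).
  by rewrite -prodr_const; apply: eq_bigr => k /eqP ->; rewrite mulr1.
rewrite -prodr_const; apply: eq_bigr => k /eqP.
by case: (X1 (ltn_ord k) w) => -> //; rewrite mulrN1.
Qed.

Lemma tails_count (w : T) :
  #|[predC [pred k : 'I_n | X k w == 1]]|%:R = n%:R - H w.
Proof.
apply/eqP; rewrite /H /heads eq_sym subr_eq -natrD addnC eqr_nat.
by rewrite cardC card_ord.
Qed.

Lemma ELG_heads (V0 K : R) : 0 < V0 -> -1 < K < 1 ->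
  ELG P V0 X n K = (n%:R^-1 * (fine 'E_P[heads X n] * ln (1 + K) +
    (n%:R - fine 'E_P[heads X n]) * ln (1 - K)))%:E.
Proof.
move=> V00 /andP[K0 K1]; rewrite EFinM -integral_affine_heads /ELG.
congr (_ * _)%E; apply: eq_integral => w _.
rewrite account_heads ?gt_eqF// lne_monomial; [|lra|lra].
by rewrite tails_count.
Qed.

(** The right-hand side is the expectation of the pointwise bound of
    [lne_monomial_le], an affine function of the number of heads. *)
Lemma ELG_heads_le (V0 K L : R) : 0 < V0 -> -1 <= K <= 1 -> -1 < L < 1 ->
  (ELG P V0 X n K <= (n%:R^-1 *
     (fine 'E_P[heads X n] * (ln (1 + L) + ((1 + K) / (1 + L) - 1)) +
      (n%:R - fine 'E_P[heads X n]) *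
        (ln (1 - L) + ((1 - K) / (1 - L) - 1))))%:E)%E.
Proof.
move=> V00 /andP[K0 K1] /andP[L0 L1]; rewrite EFinM -integral_affine_heads /ELG.
apply: lee_wpmul2l; first by rewrite lee_fin invr_ge0.
apply: le_integral_pointwise => w _.
rewrite account_heads ?gt_eqF// -tails_count; apply: lne_monomial_le; lra.
Qed.

(** For [L = 2 q - 1], [1 + L = 2 q] and [1 - L = 2 (1 - q)], so the linear
    terms of [ELG_heads_le] cancel and its bound is the growth at [L]. *)
Lemma ELG_max (V0 q K : R) : 0 < V0 -> 0 < q < 1 ->
  fine 'E_P[heads X n]%E = n%:R * q -> -1 <= K <= 1 ->
  (ELG P V0 X n K <= ELG P V0 X n (2 * q - 1))%E.
Proof.
move=> V00 /andP[q0 q1] EH hK.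
have hq : -1 < 2 * q - 1 < 1 by apply/andP; split; lra.
rewrite (le_trans (ELG_heads_le V00 hK hq))// ELG_heads// EH lee_fin.
(* Both sides are equal. *)
rewrite le_eqVlt; apply/orP; left; apply/eqP; congr (_ * _); field.
by apply/andP; split; apply/negP => /eqP; lra.
Qed.

(** * Probability of heads at each flip *)

Section markov.
Variables (xm1 w0 w1 : R).
Hypothesis xm1E : xm1 = 1 \/ xm1 = -1.

Lemma prev_pm1 k w : (k <= n)%N -> Defs.prev xm1 X k w = 1 \/ Defs.prev xm1 X k w = -1.
Proof. by case: k => [|k] // kn; exact: X1. Qed.

Lemma measurable_prev k y : measurable [set w | Defs.prev xm1 X k w = y].
Proof.
case: k => [|k]; last exact: mX.
have [<-|xy] := eqVneq xm1 y.
  by rewrite (_ : [set _ | _] = setT)//; apply/seteqP.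
rewrite (_ : [set _ | _] = set0)//; apply/seteqP; split => // w /= h.
by rewrite h eqxx in xy.
Qed.

Definition prev_head_prob k := fine (P [set w | Defs.prev xm1 X k w = 1]).

Lemma measure_split k (A : set T) : (k <= n)%N -> measurable A ->
  P A = (P (A `&` [set w | Defs.prev xm1 X k w = 1%R]%classic) +
         P (A `&` [set w | Defs.prev xm1 X k w = (-1)%R]%classic))%E.
Proof.
move=> kn mA; rewrite -measureU; last first.
- rewrite -subset0 => w [[_ /= ->] [_ /=]] h.
  have := @ltr01 R; lra.
- by apply: measurableI => //; exact: measurable_prev.
- by apply: measurableI => //; exact: measurable_prev.
congr (P _); rewrite -setIUr; apply/seteqP; split=> [w Aw|w []//].
by split => //; exact: prev_pm1.
Qed.

Hypothesis coin : history_cognizant_coin P n xm1 w0 w1 X.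

(** The product form of the transition law. It extends to pasts of probability
    0, where both sides vanish, so no flip has to be treated apart; at flip 0
    one of the two pasts has probability 0. *)
Lemma joint_prob k y : (k < n)%N ->
  fine (P ([set w | X k w = 1] `&` [set w | Defs.prev xm1 X k w = y])) =
  (w0 + w1 * y) * fine (P [set w | Defs.prev xm1 X k w = y]).
Proof.
move=> kn; set A := [set w | X k w = 1]; set B := [set w | _ = y].
have mB : measurable B by exact: measurable_prev.
have mAB : measurable (A `&` B) by apply: measurableI => //; exact: mX.
have := measure_ge0 P B; rewrite le_eqVlt => /predU1P[B0|B0].
  have AB0 : P (A `&` B) = 0%E.
    apply/eqP; rewrite eq_le measure_ge0 andbT [leRHS]B0.
    by rewrite le_measure// inE.
  by rewrite AB0 -B0 mulr0.
have [_ _ /(_ k kn y B0) <-] := coin.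
rewrite /cond_prob -/A -/B divfK// gt_eqF// fine_gt0// B0/=.
by rewrite ltey_eq fin_num_measure.
Qed.

(** [2 r - 1] is the mean of the preceding outcome when [r] is its probability
    of heads. *)
Lemma prob_head_rec k : (k < n)%N ->
  fine (P [set w | X k w = 1]) = w0 + w1 * (2 * prev_head_prob k - 1).
Proof.
move=> kn; rewrite /prev_head_prob.
have mp y : measurable [set w | Defs.prev xm1 X k w = y].
  exact: measurable_prev.
have := @measure_split k setT (ltnW kn) measurableT.
rewrite probability_setT !setTI => /(congr1 fine).
rewrite fineD ?fin_num_measure//= => tot.
rewrite (measure_split (ltnW kn))// fineD; last 2 first.
- by apply: fin_num_measure; exact: measurableI.
- by apply: fin_num_measure; exact: measurableI.
rewrite !joint_prob//; set p := fine _; set p' := fine (P _) in tot *.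
have -> : p' = 1 - p by rewrite tot addrC addKr.
ring.
Qed.

Lemma prev_head_prob0 : 2 * prev_head_prob 0 - 1 = xm1.
Proof.
rewrite /prev_head_prob/=; case: xm1E => ->.
  by rewrite (_ : [set _ | _] = setT) ?probability_setT/=; [lra|apply/seteqP].
rewrite (_ : [set _ | _] = set0) ?measure0/=; first lra.
by apply/seteqP; split => // w /= h; have := @ltr01 R; lra.
Qed.

(** The probability is [w0 + w1 e] with [|e| <= 1], hence at distance less than
    1/2 from 1/2. *)
Lemma prob_head_gt0_lt1 k : (k < n)%N -> `|w0 - 1 / 2| + `|w1| < 1 / 2 ->
  0 < fine (P [set w | X k w = 1]) < 1.
Proof.
move=> kn hw; rewrite prob_head_rec//.
set r := prev_head_prob k.
have r01 : 0 <= r <= 1.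
  rewrite /r /prev_head_prob fine_ge0//= -lee_fin fineK; last first.
    by apply: fin_num_measure; exact: measurable_prev.
  by apply: probability_le1; exact: measurable_prev.
have e1 : `|2 * r - 1| <= 1.
  by rewrite ler_norml; case/andP: r01 => *; apply/andP; split; lra.
have e2 : `|w1 * (2 * r - 1)| <= `|w1|.
  by rewrite normrM ler_piMr.
have : `|w0 - 1 / 2 + w1 * (2 * r - 1)| < 1 / 2.
  by apply: le_lt_trans (ler_normD _ _) _; apply: le_lt_trans hw; rewrite lerD2l.
by rewrite ltr_norml => /andP[? ?]; apply/andP; split; lra.
Qed.

Lemma prob_head_closed k : 2 * w1 != 1 -> (k < n)%N ->
  fine (P [set w | X k w = 1]) = (w0 - w1) / (1 - 2 * w1) +
   (2 * w1) ^+ k * (w0 + w1 * xm1 - (w0 - w1) / (1 - 2 * w1)).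
Proof.
move=> w1N; have w1D : 1 - 2 * w1 != 0 by rewrite subr_eq0 eq_sym.
elim: k => [|k IH] kn.
  by rewrite prob_head_rec// prev_head_prob0 expr0 mul1r [RHS]addrC subrK.
rewrite prob_head_rec// /prev_head_prob/= IH; last exact: ltnW.
by rewrite exprS; field.
Qed.

End markov.
End coin.

(** * Optimal fraction *)

Theorem mainTheorem1 (R : realType) (d : measure_display)
    (T : measurableType d) (P : probability T R)
    (n : nat) (hn : (1 <= n)%N)
    (xm1 : R) (hxm1 : xm1 = 1 \/ xm1 = -1)
    (w0 w1 : R) (hw : `|w0 - 1 / 2| + `|w1| < 1 / 2)
    (X : nat -> {RV P >-> R})
    (hX : history_cognizant_coin P n xm1 w0 w1 (fun k => X k))
    (V0 : R) (hV0 : 0 < V0) :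
  let EH : \bar R := 'E_P[heads (fun k => X k) n]%E in
  let Kn : R := 2 * (fine EH / n%:R) - 1 in
  let p0 : R := w0 + w1 * xm1 in
  let pinf : R := (w0 - w1) / (1 - 2 * w1) in
  let lam : R := n%:R^-1 * ((1 - (2 * w1) ^+ n) / (1 - 2 * w1)) in
  [/\ -1 <= Kn <= 1,
      forall K : R, -1 <= K <= 1 ->
        (ELG P V0 (fun k => X k) n K <= ELG P V0 (fun k => X k) n Kn)%E,
      0 <= lam <= 1 &
      ((n%:R^-1)%:E * EH)%E = (lam * p0 + (1 - lam) * pinf)%:E].
Proof.
move=> EH Kn p0 pinf lam.
have mX k y : measurable [set w | X k w = y].
  exact: (measurable_funPTI (X k) (measurable_set1 y)).
have [X1 _ _] := hX.
have n0 : 0 < n%:R :> R by rewrite ltr0n.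
have w1h : `|2 * w1| < 1.
  rewrite normrM ger0_norm//.
  by have := normr_ge0 (w0 - 1 / 2); lra.
have w1N : 2 * w1 != 1.
  by apply/eqP => h; rewrite h normr1 ltxx in w1h.
have w1D : 0 < 1 - 2 * w1.
  by rewrite subr_gt0; apply: le_lt_trans w1h; exact: ler_norm.
have EHE : EH = (\sum_(k < n) fine (P [set w | X k w = 1]))%:E.
  exact: expectation_heads.
set q := fine EH / n%:R.
have EHq : fine EH = n%:R * q by rewrite /q mulrC divfK// gt_eqF.
(* [lam] is the mean of the first [n] powers of [2 w1]. *)
have geom : (1 - (2 * w1) ^+ n) / (1 - 2 * w1) = \sum_(k < n) (2 * w1) ^+ k.
  rewrite -opprB subrX1 -(opprB _ 1) divrNN mulrC mulKf// -oppr_eq0 opprB.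
  by rewrite gt_eqF.
have q01 : 0 < q < 1.
  have hp (k : 'I_n) : 0 < fine (P [set w | X k w = 1]) < 1.
    exact: (prob_head_gt0_lt1 mX X1 hxm1 hX (ltn_ord k) hw).
  have sum_gt (F : 'I_n -> R) : (forall k, 0 < F k) -> 0 < \sum_(k < n) F k.
    move=> F0; rewrite (bigD1 (Ordinal hn))//= ltr_pwDl//.
    by apply: sumr_ge0 => k _; exact: ltW.
  rewrite /q EHE/= divr_gt0 ?ltr_pdivrMr ?mul1r//=; last first.
    by apply: sum_gt => k; case/andP: (hp k).
  rewrite -subr_gt0 -[X in X - _](_ : \sum_(k < n) 1 = _); last first.
    by rewrite sumr_const card_ord.
  by rewrite -sumrB; apply: sum_gt => k; rewrite subr_gt0; case/andP: (hp k).
split.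
- by rewrite /Kn -/q; case/andP: q01 => *; apply/andP; split; lra.
- by move=> K hK; apply: ELG_max.
- rewrite /lam mulr_ge0 ?invr_ge0//=; last first.
    rewrite divr_ge0// ?(ltW w1D)// subr_ge0 (le_trans (ler_norm _))//.
    by rewrite normrX exprn_ile1// ltW.
  rewrite ler_pdivrMl// mulr1 geom -[leRHS](_ : \sum_(k < n) 1 = _).
    apply: ler_sum => k _; rewrite (le_trans (ler_norm _))//.
    by rewrite normrX exprn_ile1// ltW.
  by rewrite sumr_const card_ord.
- rewrite EHE -EFinM; congr EFin.
  rewrite (eq_bigr (fun k : 'I_n => pinf + (2 * w1) ^+ k * (p0 - pinf))); last first.
    by move=> k _; exact: (prob_head_closed mX X1 hxm1 hX).
  rewrite big_split/= sumr_const card_ord -mulr_suml -geom -[pinf *+ n]mulr_natl.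
  rewrite /lam; move: (_ / (1 - 2 * w1)) => s; field; exact: lt0r_neq0.
Qed.
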